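(* Let $\mu$ be a spin system on $\mathcal Y=\mathcal X^{\mathcal I}$ ($\mathcal X,\mathcal I$ finite sets) satisfying a $\mathfrak d\text{-}\mathrm{LSI}(\sigma^2)$, and let $d\in\mathbb N$. For any $f:\mathcal Y\to\mathbb R$, any $t>0$ and $C=\frac{2\sigma^2(de)^2}{\log 2}$ we have $$\mu\left(|f-\mathbb E_\mu f|\ge t\right)\le2\exp\left(-\frac1C\min\left(\frac{t^{2/d}}{\|\mathfrak h^{(d)}f\|_\infty^{2/d}},\ \min_{k=1,\dots,d-1}\frac{t^{2/k}}{\|\mathfrak h^{(k)}f\|_2^{2/k}}\right)\right).$$
   Context: A spin system is a probability measure $\mu$ on $\mathcal Y=\mathcal X^{\mathcal I}$. For $x\in\mathcal Y$, $\overline x_i=(x_j)_{j\ne i}$, and $\mu(\cdot\mid\overline x_i)$ is the conditional distribution on $\mathcal X$ of the $i$-th coordinate given the others. $\mathfrak d_if(x)^2=\frac12\iint(f(\overline x_i,y)-f(\overline x_i,y'))^2\,d\mu(y\mid\overline x_i)\,d\mu(y'\mid\overline x_i)$ if $\overline x_i$ has positive marginal probability, and $0$ otherwise; $|\mathfrak df|^2=\sum_{i\in\mathcal I}(\mathfrak d_if)^2$. $\mu$ satisfies a $\mathfrak d\text{-}\mathrm{LSI}(\sigma^2)$ if $\mathrm{Ent}_\mu(f^2)\le2\sigma^2\int|\mathfrak df|^2d\mu$ for all $f:\mathcal Y\to\mathbb R$, where $\mathrm{Ent}_\mu(g)=\mathbb E_\mu g\log g-\mathbb E_\mu g\log\mathbb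 E_\mu g$. $\mathfrak h_if(x)=\max\{|f(\overline x_i,y)-f(\overline x_i,y')|: y,y'\in\mathcal X,\ \mu(y\mid\overline x_i)>0,\ \mu(y'\mid\overline x_i)>0\}$ (the $L^\infty$-norm with respect to $\mu(\cdot\mid\overline x_i)\otimes\mu(\cdot\mid\overline x_i)$; relevant only for $x\in\operatorname{supp}\mu$). Higher order differences: $\mathfrak h_{i_1\ldots i_k}f=\mathfrak h_{i_1}(\mathfrak h_{i_2\ldots i_k}f)$; $\mathfrak h^{(k)}f$ is the tensor $(\mathfrak h_{i_1\ldots i_k}f)_{(i_1,\dots,i_k)\in\mathcal I^k}$, $|\mathfrak h^{(k)}f|$ its pointwise Euclidean norm, and $\|\mathfrak h^{(k)}f\|_p$ the $L^p(\mu)$ norm of $|\mathfrak h^{(k)}f|$. Conventions: $x/0=\infty$ for $x>0$, and the minimum over an empty set (case $d=1$) is $\infty$. *)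

(* Defs.v *)
From mathcomp Require Import all_boot all_order all_algebra.
From mathcomp Require Import reals constructive_ereal sequences exp.
Set Implicit Arguments.
Unset Strict Implicit.
Unset Printing Implicit Defensive.
Import Order.TTheory GRing.Theory Num.Theory.
Local Open Scope ring_scope.

(* A spin system: a probability measure on the finite set X^I, given by its
   point masses. *)
Record spin_system (R : realType) (I X : finType) := SpinSystem {
  mass :> {ffun I -> X} -> R;
  mass_ge0 : forall x, 0 <= mass x;
  mass_sum1 : \sum_(x : {ffun I -> X}) mass x = 1
}.

Section SpinSystem.
Variables (R : realType) (I X : finType).
Local Notation Y := {ffun I -> X}.
Variable mu : spin_system R I X.
Implicit Types (f g : Y -> R) (x : Y) (y : X) (i : I).

Definition Prob (A : pred Y) : R := \sum_(x | A x) mu x.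
Definition Exp g : R := \sum_x mu x * g x.

(* As [ln 0 = 0], the convention 0 log 0 = 0 is respected. *)
Definition Ent g : R := Exp (fun x => g x * ln (g x)) - Exp g * ln (Exp g).

(* The configuration (xbar_i, y): the i-th coordinate of x is replaced by y. *)
Definition subst x i y : Y := [ffun j => if j == i then y else x j].

Definition marginal i x : R := \sum_y mu (subst x i y).

(* mu(y | xbar_i); it vanishes when [marginal i x = 0], as 0^-1 = 0. *)
Definition cond i x y : R := mu (subst x i y) / marginal i x.

Definition diff_d i f x : R :=
  if 0 < marginal i x then
    Num.sqrt (2^-1 * \sum_y \sum_y'
      (f (subst x i y) - f (subst x i y')) ^+ 2 * cond i x y * cond i x y')
  else 0.

(* |d f|^2 *)
Definition sqnorm_d f x : R := \sum_i (diff_d i f x) ^+ 2.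

Definition dLSI (s2 : R) : Prop :=
  forall f, Ent (fun x => f x ^+ 2) <= 2 * s2 * Exp (sqnorm_d f).

(* The maximum ranges over a nonempty set of nonnegative reals as soon as
   [marginal i x > 0], in particular on the support of mu; the base value 0
   only matters elsewhere. *)
Definition diff_h i f x : R :=
  \big[Num.max/0]_(p : X * X | (0 < cond i x p.1) && (0 < cond i x p.2))
    `|f (subst x i p.1) - f (subst x i p.2)|.

(* [diff_hs [:: i1; ..; ik] f] is h_{i1}(h_{i2}(.. (h_{ik} f))). *)
Definition diff_hs (s : seq I) f : Y -> R := foldr diff_h f s.

(* |h^(k) f|, the pointwise Euclidean norm of the k-tensor. *)
Definition norm_h (k : nat) f x : R :=
  Num.sqrt (\sum_(s : k.-tuple I) (diff_hs s f x) ^+ 2).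

Definition L2norm g : R := Num.sqrt (Exp (fun x => `|g x| ^+ 2)).

(* The essential supremum of |g| with respect to mu. *)
Definition Loonorm g : R := \big[Num.max/0]_(x | 0 < mu x) `|g x|.

End SpinSystem.

(* Main.v *)
(* Write |h^(k) f| for the Euclidean norm of the tensor of k-th differences.
   Differentiating p |-> ||g||_p^2 produces the entropy of g^p, which the
   log-Sobolev inequality applied to g^(p/2) bounds; hence for p >= 2
     ||g||_p^2 <= ||g||_2^2 + sigma^2 (p - 2) ||h g||_p^2     (g >= 0).
   As Ent(f^2) >= Var f for f >= 0, also Var f <= 2 sigma^2 E|d f|^2, which is
   at most sigma^2 ||h f||_2^2.  Since |h |h^(k) f|| <= |h^(k+1) f|, iterating gives
     ||f - E f||_p^2 <= sum_(0 < k < d) (sigma^2 p)^k ||h^(k) f||_2^2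
                        + (sigma^2 p)^d ||h^(d) f||_oo^2.
   With eta the minimum in the exponent and p = eta / (sigma d e)^2, each of the
   d terms is at most t^2 / (d e)^2, and Markov's inequality yields exp(-p)
   when p >= 2; for p < 2 the right-hand side of the claim is at least 1. *)
Require Import Defs.
From mathcomp Require Import all_boot all_order all_algebra.
From mathcomp Require Import reals constructive_ereal sequences exp.
From mathcomp Require Import boolp functions topology normedtype derive realfun ring lra.
Set Implicit Arguments.
Unset Strict Implicit.
Unset Printing Implicit Defensive.
Import Order.TTheory GRing.Theory Num.Theory.
Import numFieldNormedType.Exports.
Local Open Scope ring_scope.

(** * Convexity inequalities for real powers *)

Section PowR.
Variable R : realType.
Implicit Types (a b p r th : R).

(** Young's inequality for the conjugate exponents [th^-1] and [(1 - th)^-1]. *)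
Lemma powR_amgm a b th : 0 <= a -> 0 <= b -> 0 < th < 1 ->
  a `^ th * b `^ (1 - th) <= th * a + (1 - th) * b.
Proof.
move=> a0 b0 /andP[th0 th1].
have th1' : 0 < 1 - th by rewrite subr_gt0.
have := @conjugate_powR R (a `^ th) (b `^ (1 - th)) th^-1 (1 - th)^-1
  (powR_ge0 _ _) (powR_ge0 _ _).
rewrite -!powRrM !invrK !invr_gt0 !mulfV ?gt_eqF// !powRr1// ![_ * th]mulrC.
by rewrite ![_ * (1 - th)]mulrC; apply => //; rewrite addrC subrK.
Qed.

(** The graph of the r-th power lies above its tangent at [a]: weighted AM-GM with weight [r^-1] on
    [b]^ r[bounds]b * a [^ (r - 1)]. *)
Lemma powR_sub_le a b r : 0 <= b -> b <= a -> 1 < r ->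
  a `^ r - b `^ r <= r * a `^ (r - 1) * (a - b).
Proof.
move=> b0 ba r1; have a0 : 0 <= a by exact: le_trans ba.
have r0 : 0 < r by exact: lt_trans r1.
have rV : 0 < r^-1 < 1 by rewrite invr_gt0 r0 invf_lt1.
have := powR_amgm (powR_ge0 b r) (powR_ge0 a r) rV.
rewrite -!powRrM mulfV ?gt_eqF// powRr1// mulrBr mulr1 mulfV ?gt_eqF//.
rewrite -(ler_pM2l r0) mulrDr !mulrA mulrBr mulr1 mulfV ?gt_eqF// mul1r.
by have := mulr_powRB1 a0 r0; nra.
Qed.

(** The tangent bound with exponent [p / 2] gives the larger of the two powers alone; their sum
    makes the bound symmetric in the two values, of the form K(a) + K(b) once [(a - b) ^+ 2] is
    replaced by a common bound. *)
Lemma powR_half_sub_sqr_le a b p : 0 <= a -> 0 <= b -> 2 < p ->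
  (a `^ (p / 2) - b `^ (p / 2)) ^+ 2 <=
  (p / 2) ^+ 2 * (a - b) ^+ 2 * (a `^ (p - 2) + b `^ (p - 2)).
Proof.
wlog ba : a b / b <= a => [wlg a0 b0 p2|a0 b0 p2].
  case/orP: (le_total b a) => ab; first exact: wlg.
  rewrite -sqrrN opprB -(sqrrN (a - b)) opprB.
  by rewrite [a `^ (p - 2) + _]addrC; exact: wlg.
have r1 : 1 < p / 2 by lra.
have le0 : 0 <= a `^ (p / 2) - b `^ (p / 2).
  by rewrite subr_ge0 ge0_ler_powR ?nnegrE//; lra.
have le1 := powR_sub_le b0 ba r1.
apply: (@le_trans _ _ ((p / 2) ^+ 2 * (a - b) ^+ 2 * a `^ (p - 2))); last first.
  apply: ler_wpM2l; first by rewrite mulr_ge0 ?sqr_ge0.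
  by rewrite lerDl powR_ge0.
have -> : a `^ (p - 2) = (a `^ (p / 2 - 1)) ^+ 2.
  by rewrite -powR_mulrn ?powR_ge0// -powRrM; congr powR; field.
by rewrite -!exprMn mulrAC lerXn2r// nnegrE (le_trans le0).
Qed.

End PowR.

(** * Expectations, Hoelder's inequality and squared L^p norms *)

Section Expectation.
Variables (R : realType) (I X : finType) (mu : spin_system R I X).
Local Notation Y := {ffun I -> X}.
Implicit Types (f g h u v : Y -> R) (x : Y) (p q : R).

Lemma ExpD f g : Exp mu (fun x => f x + g x) = Exp mu f + Exp mu g.
Proof. by rewrite /Exp -big_split; apply: eq_bigr => x _; rewrite mulrDr. Qed.

Lemma ExpZ (c : R) f : Exp mu (fun x => c * f x) = c * Exp mu f.
Proof. by rewrite /Exp mulr_sumr; apply: eq_bigr => x _; rewrite mulrCA. Qed.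

Lemma Exp_cst (c : R) : Exp mu (fun=> c) = c.
Proof. by rewrite /Exp -mulr_suml mass_sum1 mul1r. Qed.

Lemma Exp_sum (J : finType) (F : J -> Y -> R) :
  Exp mu (fun x => \sum_j F j x) = \sum_j Exp mu (F j).
Proof. by rewrite /Exp exchange_big; apply: eq_bigr => x _; rewrite mulr_sumr. Qed.

Lemma eq_Exp f g : (forall x, 0 < mu x -> f x = g x) -> Exp mu f = Exp mu g.
Proof.
move=> fg; apply: eq_bigr => x _; have := mass_ge0 mu x.
by rewrite le_eqVlt => /predU1P[<-|/fg->//]; rewrite !mul0r.
Qed.

Lemma ler_Exp f g : (forall x, 0 < mu x -> f x <= g x) -> Exp mu f <= Exp mu g.
Proof.
move=> fg; apply: ler_sum => x _; have := mass_ge0 mu x.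
by rewrite le_eqVlt => /predU1P[<-|x0]; rewrite ?mul0r// ler_pM2l// fg.
Qed.

Lemma Exp_ge0 f : (forall x, 0 <= f x) -> 0 <= Exp mu f.
Proof. by move=> f0; apply: sumr_ge0 => x _; rewrite mulr_ge0 ?mass_ge0. Qed.

Lemma Exp_eq0 f : (forall x, 0 <= f x) -> Exp mu f = 0 ->
  forall x, 0 < mu x -> f x = 0.
Proof.
move=> f0 E0 x x0.
have /psumr_eq0P/(_ _ x isT)/eqP : forall z, true -> 0 <= mu z * f z.
  by move=> z _; rewrite mulr_ge0 ?mass_ge0.
by rewrite -/(Exp mu f) E0 => /(_ erefl); rewrite mulf_eq0 gt_eqF//= => /eqP.
Qed.

(** Divide [u] and [v] by their means and integrate the weighted AM-GM inequality. If one mean is 0,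
    that function vanishes on the support of [mu], and both sides are 0. *)
Lemma Exp_hoelder u v (th : R) : 0 < th < 1 ->
  (forall x, 0 <= u x) -> (forall x, 0 <= v x) ->
  Exp mu (fun x => u x `^ th * v x `^ (1 - th)) <=
  Exp mu u `^ th * Exp mu v `^ (1 - th).
Proof.
move=> th01 u0 v0; have /andP[th0 th1] := th01.
have th1' : 0 < 1 - th by rewrite subr_gt0.
have := Exp_ge0 u0; rewrite le_eqVlt => /predU1P[Eu|Eu].
  rewrite (@eq_Exp _ (fun=> 0)) ?Exp_cst ?mulr_ge0 ?powR_ge0// => x x0.
  by rewrite (Exp_eq0 u0 (esym Eu) x0) powR0 ?mul0r ?gt_eqF.
have := Exp_ge0 v0; rewrite le_eqVlt => /predU1P[Ev|Ev].
  rewrite (@eq_Exp _ (fun=> 0)) ?Exp_cst ?mulr_ge0 ?powR_ge0// => x x0.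
  by rewrite (Exp_eq0 v0 (esym Ev) x0) [0 `^ (1 - th)]powR0 ?mulr0 ?gt_eqF.
set A := Exp mu u in Eu *; set B := Exp mu v in Ev *.
pose c := A `^ th * B `^ (1 - th).
apply: (@le_trans _ _ (Exp mu (fun x => c * (th / A) * u x + c * ((1 - th) / B) * v x))).
  apply: ler_Exp => x _.
  have -> : u x `^ th * v x `^ (1 - th) =
      c * ((u x / A) `^ th * (v x / B) `^ (1 - th)).
    rewrite mulrACA -!powRM ?divr_ge0 ?(ltW Eu) ?(ltW Ev)//.
    by rewrite ![_ * (_ / _)]mulrC !divfK ?gt_eqF.
  have -> : c * (th / A) * u x + c * ((1 - th) / B) * v x =
      c * (th * (u x / A) + (1 - th) * (v x / B)) by field; rewrite !gt_eqF.
  apply: ler_wpM2l; first by rewrite mulr_ge0 ?powR_ge0.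
  by apply: powR_amgm; rewrite ?divr_ge0 ?(ltW Eu) ?(ltW Ev).
rewrite ExpD !ExpZ -/A -/B.
suff -> : c * (th / A) * A + c * ((1 - th) / B) * B = c by [].
by field; rewrite !gt_eqF.
Qed.

(** The square of the L^p norm, for nonnegative [g]; no absolute value is taken. *)
Definition sqLp p g : R := Exp mu (fun x => g x `^ p) `^ (2 / p).

Lemma sqLp_ge0 p g : 0 <= sqLp p g. Proof. exact: powR_ge0. Qed.

Lemma sqLp2 g : (forall x, 0 <= g x) -> sqLp 2 g = Exp mu (fun x => g x ^+ 2).
Proof.
move=> g0; rewrite /sqLp mulfV ?pnatr_eq0// powRr1; last by apply: Exp_ge0 => x; exact: powR_ge0.
by apply: eq_Exp => x _; rewrite powR_mulrn.
Qed.

Lemma ler_sqLp p g h : 0 < p -> (forall x, 0 <= g x) ->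
  (forall x, 0 < mu x -> g x <= h x) -> sqLp p g <= sqLp p h.
Proof.
move=> p0 g0 gh; have p0' : 0 <= 2 / p by rewrite divr_ge0// ltW.
rewrite ge0_ler_powR ?nnegrE ?Exp_ge0// => [x|x|]; try exact: powR_ge0.
apply: ler_Exp => x x0.
by rewrite ge0_ler_powR ?nnegrE ?(ltW p0) ?gh// (le_trans (g0 x)) ?gh.
Qed.

Lemma sqLp_cst p (c : R) : 0 < p -> 0 <= c -> sqLp p (fun=> c) = c ^+ 2.
Proof.
move=> p0 c0; rewrite /sqLp Exp_cst -powRrM -powR_mulrn//.
by congr powR; field; rewrite gt_eqF.
Qed.

(** Hoelder's inequality for g^q against the constant 1, with weight [p / q]. *)
Lemma sqLp_mono p q g : 0 < p -> p <= q -> (forall x, 0 <= g x) ->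
  sqLp p g <= sqLp q g.
Proof.
move=> p0; rewrite le_eqVlt => /predU1P[->//|pq] g0.
have q0 : 0 < q by exact: lt_trans pq.
have th : 0 < p / q < 1 by rewrite divr_gt0//= ltr_pdivrMr// mul1r.
have := Exp_hoelder th (fun x => powR_ge0 (g x) q) (fun=> ler01).
rewrite Exp_cst powR1 mulr1.
rewrite (@eq_Exp _ (fun x => g x `^ p)); last first.
  move=> x _; rewrite mulr1 -powRrM; congr powR; field; exact: lt0r_neq0.
move=> le; rewrite /sqLp.
have p0' : 0 <= 2 / p by rewrite divr_ge0// ltW.
have := ge0_ler_powR p0' _ _ le.
rewrite !nnegrE powR_ge0 Exp_ge0 => [|x]; last exact: powR_ge0.
move=> /(_ isT isT)/le_trans; apply.
by rewrite -powRrM le_eqVlt; apply/orP; left; apply/eqP; congr powR; field; rewrite !gt_eqF.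
Qed.

End Expectation.

(** * Resampling one coordinate; comparison of the two difference operators *)

Section Differences.
Variables (R : realType) (I X : finType) (mu : spin_system R I X).
Local Notation Y := {ffun I -> X}.
Implicit Types (f g h : Y -> R) (x : Y) (y z : X) (i : I).

Lemma subst_same x i y : subst x i y i = y.
Proof. by rewrite ffunE eqxx. Qed.

Lemma substK x i : subst x i (x i) = x.
Proof. by apply/ffunP => j; rewrite ffunE; case: eqP => // ->. Qed.

Lemma subst_subst x i y z : subst (subst x i y) i z = subst x i z.
Proof. by apply/ffunP => j; rewrite !ffunE; case: eqP. Qed.

Lemma marginal_subst i x y : marginal mu i (subst x i y) = marginal mu i x.
Proof. by apply: eq_bigr => z _; rewrite subst_subst. Qed.

Lemma cond_subst i x y z : cond mu i (subst x i y) z = cond mu i x z.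
Proof. by rewrite /cond marginal_subst subst_subst. Qed.

Lemma diff_h_subst i f x y : diff_h mu i f (subst x i y) = diff_h mu i f x.
Proof.
rewrite /diff_h; apply: eq_big => [p|p _]; first by rewrite !cond_subst.
by rewrite !subst_subst.
Qed.

Lemma marginal_ge0 i x : 0 <= marginal mu i x.
Proof. by apply: sumr_ge0 => y _; exact: mass_ge0. Qed.

Lemma cond_ge0 i x y : 0 <= cond mu i x y.
Proof. by rewrite divr_ge0 ?mass_ge0 ?marginal_ge0. Qed.

Lemma mass_marginal_gt0 i x : 0 < mu x -> 0 < marginal mu i x.
Proof.
move=> x0; rewrite /marginal (bigD1 (x i))//= substK ltr_wpDr//.
by apply: sumr_ge0 => y _; exact: mass_ge0.
Qed.

Lemma sum_cond i x : 0 < marginal mu i x -> \sum_y cond mu i x y = 1.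
Proof. by move=> m0; rewrite -mulr_suml mulfV ?gt_eqF. Qed.

(* The sum is reindexed by the involution exchanging the resampled value of the
   i-th coordinate with the old one. *)
Lemma Exp_resample i f :
  Exp mu (fun x => \sum_y cond mu i x y * f (subst x i y)) = Exp mu f.
Proof.
pose T (p : Y * X) := (subst p.1 i p.2, p.1 i).
have TK : involutive T.
  by case=> x y; rewrite /T /= subst_subst substK subst_same.
rewrite {1}/Exp; under eq_bigr do rewrite mulr_sumr.
rewrite pair_big /= (reindex_inj (inv_inj TK)) /=.
rewrite -(pair_big xpredT xpredT (fun x y =>
  mu (subst x i y) * (cond mu i (subst x i y) (x i) *
    f (subst (subst x i y) i (x i))))) /=.
apply: eq_bigr => x _.
under eq_bigr do rewrite cond_subst subst_subst substK.
rewrite -mulr_suml -/(marginal mu i x) /cond substK mulrA mulrCA.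
have := mass_ge0 mu x; rewrite le_eqVlt => /predU1P[<-|x0]; first by rewrite !mul0r.
by rewrite mulfV ?mulr1// gt_eqF// mass_marginal_gt0.
Qed.

Lemma diff_h_ge0 i f x : 0 <= diff_h mu i f x.
Proof. by rewrite /diff_h; elim/big_ind: _ => // a b a0 b0; rewrite le_max a0. Qed.

Lemma le_diff_h i f x y z : 0 < cond mu i x y -> 0 < cond mu i x z ->
  `|f (subst x i y) - f (subst x i z)| <= diff_h mu i f x.
Proof.
move=> y0 z0; rewrite /diff_h.
apply: (@le_bigmax_cond _ _ _ _ (y, z) _
  (fun p : X * X => `|f (subst x i p.1) - f (subst x i p.2)|)).
by rewrite /= y0.
Qed.

Lemma diff_h_le i f x (c : R) : 0 <= c ->
  (forall y z, 0 < cond mu i x y -> 0 < cond mu i x z ->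
    `|f (subst x i y) - f (subst x i z)| <= c) -> diff_h mu i f x <= c.
Proof. by move=> c0 H; apply: bigmax_le => // p /andP[]; exact: H. Qed.

(* The coefficients 1/2 and the symmetric bound [K y + K z] match, so that no
   factor 2 is lost. *)
Lemma sqr_diff_d_le i f x (K : X -> R) :
  (forall y z, 0 < cond mu i x y -> 0 < cond mu i x z ->
    (f (subst x i y) - f (subst x i z)) ^+ 2 <= K y + K z) ->
  diff_d mu i f x ^+ 2 <= \sum_y cond mu i x y * K y.
Proof.
move=> HK; rewrite /diff_d; case: ifPn => [m0|]; last first.
  rewrite -leNgt => m0; have {}m0 : marginal mu i x = 0.
    by apply/eqP; rewrite eq_le m0 marginal_ge0.
  by rewrite big1 ?expr0n// => y _; rewrite /cond m0 invr0 mulr0 mul0r.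
rewrite sqr_sqrtr; last first.
  apply: mulr_ge0; first by rewrite invr_ge0.
  apply: sumr_ge0 => y _; apply: sumr_ge0 => z _.
  by apply: mulr_ge0 (cond_ge0 _ _ _); rewrite mulr_ge0 ?cond_ge0 ?sqr_ge0.
rewrite mulrC ler_pdivrMr//.
apply: (@le_trans _ _ (\sum_y \sum_z (K y + K z) * cond mu i x y * cond mu i x z)).
  apply: ler_sum => y _; apply: ler_sum => z _; rewrite -[leLHS]mulrA -[leRHS]mulrA.
  have := cond_ge0 i x y; rewrite le_eqVlt => /predU1P[<-|y0].
    by rewrite !(mul0r,mulr0).
  have := cond_ge0 i x z; rewrite le_eqVlt => /predU1P[<-|z0].
    by rewrite !(mul0r,mulr0).
  by apply: ler_wpM2r; [rewrite mulr_ge0 ?ltW | exact: HK].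
set c := cond mu i x; set S := \sum_y c y * K y.
have c1 : \sum_y c y = 1 by exact: sum_cond.
suff -> : \sum_y \sum_z (K y + K z) * c y * c z = S * 2 by [].
have -> : \sum_y \sum_z (K y + K z) * c y * c z = \sum_y (c y * K y + c y * S).
  apply: eq_bigr => y _; rewrite /S -[c y * K y]mulr1 -c1 !mulr_sumr -big_split /=.
  by apply: eq_bigr => z _; ring.
by rewrite big_split /= -mulr_suml c1 -/S; ring.
Qed.

(** Resampling coordinate [i] preserves [mu], so the conditional mean of [K] integrates to its mean.
    One of the two resampled values may be taken to be [x i]. *)
Lemma Exp_sqr_diff_d_le i f (K : Y -> R) :
  (forall x y, 0 < cond mu i x (x i) -> 0 < cond mu i x y ->
    (f x - f (subst x i y)) ^+ 2 <= K x + K (subst x i y)) ->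
  Exp mu (fun x => diff_d mu i f x ^+ 2) <= Exp mu K.
Proof.
move=> HK; rewrite -(Exp_resample i K); apply: ler_Exp => x _.
apply: (sqr_diff_d_le (K := fun y => K (subst x i y))) => y z y0 z0.
rewrite -[subst x i z](subst_subst x i y); apply: HK;
by rewrite ?subst_same cond_subst.
Qed.

Lemma Exp_sqnorm_d f (K : I -> Y -> R) :
  (forall i x y, 0 < cond mu i x (x i) -> 0 < cond mu i x y ->
    (f x - f (subst x i y)) ^+ 2 <= K i x + K i (subst x i y)) ->
  Exp mu (sqnorm_d mu f) <= Exp mu (fun x => \sum_i K i x).
Proof.
by move=> HK; rewrite !Exp_sum; apply: ler_sum => i _; exact/Exp_sqr_diff_d_le/HK.
Qed.

Lemma le_diff_h_self i f x y : 0 < cond mu i x (x i) -> 0 < cond mu i x y ->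
  (f x - f (subst x i y)) ^+ 2 <= diff_h mu i f x ^+ 2.
Proof.
move=> x0 y0; rewrite -real_normK ?num_real// lerXn2r ?nnegrE ?diff_h_ge0//.
by have := le_diff_h f x0 y0; rewrite substK.
Qed.

(** Half of (h_i f)^2 serves as [K]: since h_i f does not depend on coordinate [i], the two halves
    add up to the full square. *)
Lemma Exp_sqnorm_d_le f :
  2 * Exp mu (sqnorm_d mu f) <= Exp mu (fun x => \sum_i diff_h mu i f x ^+ 2).
Proof.
rewrite mulrC -ler_pdivlMr// mulrC -ExpZ.
under [X in _ <= X]eq_Exp do rewrite mulr_sumr.
apply: (Exp_sqnorm_d (K := fun i x => 2^-1 * diff_h mu i f x ^+ 2)) => i x y x0 y0.
have := le_diff_h_self f x0 y0.
by rewrite diff_h_subst; lra.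
Qed.

Lemma Exp_sqnorm_d_powR_le g p : 2 < p -> (forall x, 0 <= g x) ->
  Exp mu (sqnorm_d mu (fun x => g x `^ (p / 2))) <=
  (p / 2) ^+ 2 * Exp mu (fun x => g x `^ (p - 2) * \sum_i diff_h mu i g x ^+ 2).
Proof.
move=> p2 g0; rewrite -ExpZ.
under [X in _ <= X]eq_Exp do rewrite mulrA mulr_sumr.
apply: (Exp_sqnorm_d (K := fun i x =>
  (p / 2) ^+ 2 * g x `^ (p - 2) * diff_h mu i g x ^+ 2)) => i x y x0 y0.
apply: le_trans (powR_half_sub_sqr_le (g0 x) (g0 _) p2) _.
have := le_diff_h_self g x0 y0; rewrite diff_h_subst => le.
rewrite -mulrDl -mulrDr mulrAC ler_wpM2l// mulr_ge0 ?sqr_ge0//.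
by rewrite addr_ge0 ?powR_ge0.
Qed.

End Differences.

(** * Derivatives of moments and of squared norms in the exponent *)

Section Derivative.
Variables (R : realType) (T : finType).

(** With [c] the masses and [l] the logarithm of a positive g, the sum is the moment E g^q as a
    function of q. *)
Lemma is_derive_sum_expR (c l : T -> R) (p : R) :
  is_derive p 1 (fun q => \sum_i c i * expR (q * l i))
    (\sum_i c i * (l i * expR (p * l i))).
Proof.
have -> : (fun q => \sum_i c i * expR (q * l i)) =
    \sum_i (fun q => c i * expR (q * l i)).
  by apply/funext => q; rewrite fct_sumE.
elim/big_ind2: _ => [|f df g dg ? ?|i _]; first exact: is_derive_cst.
  exact: is_deriveD.
have -> : (fun q => c i * expR (q * l i)) = c i *: (expR \o (l i *: id)).
  by apply/funext => q; rewrite [q * _]mulrC.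
apply: is_derive_eq.
rewrite -[LHS]/(c i * (expR (l i * p) * (l i * 1))).
by rewrite mulr1 [l i * p]mulrC [l i * _]mulrC.
Qed.

(** The function is S(q)^(2/q). For S(q) = E g^q, the last factor of the derivative is the entropy
    of g^p. *)
Lemma is_derive_expR_ln_div (S : R -> R) (p dS : R) : 0 < p -> 0 < S p ->
  is_derive p 1 S dS ->
  is_derive p 1 (fun q => expR (2 / q * ln (S q)))
    (expR (2 / p * ln (S p)) * (2 / (p ^+ 2 * S p) * (p * dS - S p * ln (S p)))).
Proof.
move=> p0 Sp0 HS.
have -> : (fun q => expR (2 / q * ln (S q))) =
    expR \o ((2 *: (fun q => q^-1)) * (@ln R \o S)).
  by apply/funext => q.
have dV : is_derive p 1 (fun q : R => q^-1) (- p ^- 2).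
  have := @is_deriveV R id p 1 1 (lt0r_neq0 p0) (is_derive_id _ _).
  by rewrite /GRing.scale /= mulr1.
have dln : is_derive (S p) 1 (@ln R) (S p)^-1 by exact: is_derive1_ln.
apply: is_derive_eq.
rewrite -[LHS]/(expR (2 / p * ln (S p)) *
  (2 / p * ((S p)^-1 * dS) + ln (S p) * (2 * - p ^- 2))).
by field; rewrite !gt_eqF.
Qed.

End Derivative.

(** * Consequences of the log-Sobolev inequality: spectral gap and growth of norms *)

Section LogSobolev.
Variables (R : realType) (I X : finType) (mu : spin_system R I X).
Local Notation Y := {ffun I -> X}.
Implicit Types (f g h : Y -> R) (x : Y) (p q : R).

Lemma Exp_sqr_sub f (c : R) :
  Exp mu (fun x => (f x - c) ^+ 2) =
  Exp mu (fun x => f x ^+ 2) - 2 * c * Exp mu f + c ^+ 2.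
Proof.
rewrite -[c ^+ 2 in RHS](Exp_cst mu) -mulNr -ExpZ -!ExpD.
by apply: eq_Exp => x _; ring.
Qed.

Lemma variance_le_Ent f : (forall x, 0 <= f x) ->
  Exp mu (fun x => (f x - Exp mu f) ^+ 2) <= Ent mu (fun x => f x ^+ 2).
Proof.
move=> f0; rewrite Exp_sqr_sub /Ent.
set N2 := Exp mu (fun x => f x ^+ 2).
have N2ge0 : 0 <= N2 by apply: Exp_ge0 => x; exact: sqr_ge0.
(* The left-hand side exceeds the variance by the square of [Num.sqrt N2 - Exp mu f]. *)
suff : 2 * N2 - 2 * Num.sqrt N2 * Exp mu f <=
    Exp mu (fun x => f x ^+ 2 * ln (f x ^+ 2)) - N2 * ln N2.
  by have := sqr_sqrtr N2ge0; have := sqr_ge0 (Num.sqrt N2 - Exp mu f); nra.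
(* Integrate u ln (u / N2) >= 2 u - 2 sqrt (u N2), u = f^2, which is ln z <= z - 1
   at z = sqrt (N2 / u). *)
move: N2ge0; rewrite le_eqVlt => /predU1P[N20|N2gt0].
  rewrite -N20 sqrtr0 !(mulr0, mul0r, subr0).
  rewrite (@eq_Exp _ _ _ _ _ (fun=> 0)) ?Exp_cst// => x x0.
  by rewrite (Exp_eq0 (fun z => sqr_ge0 (f z)) (esym N20) x0) mul0r.
have N0 : 0 < Num.sqrt N2 by rewrite sqrtr_gt0.
have -> : 2 * N2 - 2 * Num.sqrt N2 * Exp mu f =
    Exp mu (fun x => 2 * f x ^+ 2 + - (2 * Num.sqrt N2) * f x).
  by rewrite ExpD !ExpZ mulNr.
have -> : Exp mu (fun x => f x ^+ 2 * ln (f x ^+ 2)) - N2 * ln N2 =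
    Exp mu (fun x => f x ^+ 2 * ln (f x ^+ 2) + - ln N2 * f x ^+ 2).
  by rewrite ExpD ExpZ mulNr mulrC.
have -> : ln N2 = 2 * ln (Num.sqrt N2).
  by rewrite -{1}(sqr_sqrtr (ltW N2gt0)) lnXn// mulr_natl.
apply: ler_Exp => x _; have := f0 x; rewrite le_eqVlt => /predU1P[<-|fx].
  by rewrite expr0n /= !(mulr0, mul0r, addr0).
have := @le_ln1Dx R (Num.sqrt N2 / f x - 1).
rewrite ltrBrDr addNr addrC subrK divr_gt0// => /(_ isT).
rewrite ln_div ?posrE// lnXn// -mulr_natl -(ler_pM2l (exprn_gt0 2 fx)).
have -> : f x ^+ 2 * (Num.sqrt N2 / f x - 1) = f x * Num.sqrt N2 - f x ^+ 2.
  by field; rewrite gt_eqF.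
by lra.
Qed.

Variable sigma : R.
Hypothesis hLSI : dLSI mu (sigma ^+ 2).

(** For nonnegative functions the variance is at most the entropy of the square. Adding the constant
    [c], which dominates |f|, makes the function nonnegative and changes neither the variance nor
    the differences. *)
Lemma poincare f :
  Exp mu (fun x => (f x - Exp mu f) ^+ 2) <=
  sigma ^+ 2 * Exp mu (fun x => \sum_i diff_h mu i f x ^+ 2).
Proof.
pose c := \sum_x `|f x|; pose g x := f x + c.
have g0 x : 0 <= g x.
  rewrite /g /c (bigD1 x)//= addrA addr_ge0 ?sumr_ge0//.
  by have := ler_norm (- f x); rewrite normrN; lra.
have -> : Exp mu (fun x => (f x - Exp mu f) ^+ 2) =
    Exp mu (fun x => (g x - Exp mu g) ^+ 2).
  apply: eq_Exp => x _; rewrite /g ExpD Exp_cst; congr (_ ^+ 2); ring.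
apply: le_trans (variance_le_Ent g0) _; apply: le_trans (hLSI g) _.
rewrite mulrAC [leLHS]mulrC ler_wpM2l ?sqr_ge0//.
have -> : Exp mu (fun x => \sum_i diff_h mu i f x ^+ 2) =
    Exp mu (fun x => \sum_i diff_h mu i g x ^+ 2).
  apply: eq_Exp => x _; apply: eq_bigr => i _; congr (_ ^+ 2).
  apply: eq_bigr => z _; congr `|_|; rewrite /g; ring.
exact: Exp_sqnorm_d_le.
Qed.

(** Apply the log-Sobolev inequality to g^(p/2), then separate g^(p-2) from h^2 by Hoelder's
    inequality for g^p and h^p with weights 1 - 2/p and 2/p. *)
Lemma Ent_powR_le g h p : 2 < p -> (forall x, 0 <= g x) -> (forall x, 0 <= h x) ->
  (forall x, \sum_i diff_h mu i g x ^+ 2 <= h x ^+ 2) ->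
  Ent mu (fun x => g x `^ p) <=
  sigma ^+ 2 * p ^+ 2 / 2 * (Exp mu (fun x => g x `^ p) `^ (1 - 2 / p) * sqLp mu p h).
Proof.
move=> p2 g0 h0 gh; have p0 : 0 < p by lra.
have -> : Ent mu (fun x => g x `^ p) = Ent mu (fun x => (g x `^ (p / 2)) ^+ 2).
  rewrite /Ent.
  have E x : g x `^ p = (g x `^ (p / 2)) ^+ 2.
    by rewrite -powR_mulrn ?powR_ge0// -powRrM divfK ?pnatr_eq0.
  by congr (_ - _ * ln _); apply: eq_Exp => x _; rewrite E.
apply: le_trans (hLSI _) _.
have -> : sigma ^+ 2 * p ^+ 2 / 2 = 2 * sigma ^+ 2 * (p / 2) ^+ 2 by field.
rewrite -[leRHS]mulrA; apply: ler_wpM2l; first by rewrite mulr_ge0 ?sqr_ge0.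
apply: le_trans (Exp_sqnorm_d_powR_le mu p2 g0) _.
rewrite ler_wpM2l ?sqr_ge0//.
have th : 0 < 1 - 2 / p < 1.
  by rewrite subr_gt0 ltr_pdivrMr// mul1r p2 gtrBl divr_gt0.
have := Exp_hoelder mu th (fun x => powR_ge0 (g x) p) (fun x => powR_ge0 (h x) p).
have -> : 1 - (1 - 2 / p) = 2 / p by ring.
apply: le_trans; apply: ler_Exp => x _; rewrite -!powRrM.
have -> : p * (1 - 2 / p) = p - 2 by field; rewrite gt_eqF.
have -> : p * (2 / p) = 2 by field; rewrite gt_eqF.
by rewrite powR_mulrn// ler_wpM2l ?powR_ge0.
Qed.

(** The derivative of ||g||_q^2 in q is at most sigma^2 ||h||_p^2 for q in (2, p]; the mean value
    theorem on [2, p] concludes. *)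
Lemma sqLp_growth g h p : 2 <= p -> (forall x, 0 <= g x) -> (forall x, 0 <= h x) ->
  (forall x, \sum_i diff_h mu i g x ^+ 2 <= h x ^+ 2) ->
  sqLp mu p g <= sqLp mu 2 g + sigma ^+ 2 * (p - 2) * sqLp mu p h.
Proof.
rewrite le_eqVlt => /predU1P[<- *|p2 g0 h0 gh]; first by rewrite subrr mulr0 mul0r addr0.
pose c x := if 0 < g x then mu x else 0.
pose S q := \sum_x c x * expR (q * ln (g x)).
have SE q : q != 0 -> S q = Exp mu (fun x => g x `^ q).
  move=> q0; apply: eq_bigr => x _; rewrite /c /powR; have := g0 x.
  rewrite le_eqVlt => /predU1P[<-|gx]; first by rewrite ltxx eqxx (negbTE q0) mul0r mulr0.
  by rewrite gx gt_eqF.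
have c0 x : 0 <= c x by rewrite /c; case: ifP => // _; exact: mass_ge0.
have [/existsP[z cz]|/existsPn cz] := boolP [exists x, 0 < c x]; last first.
  have -> : sqLp mu p g = 0.
    have p0 : p != 0 by rewrite gt_eqF//; lra.
    rewrite /sqLp -SE// [S p]big1 => [|x _]; first by rewrite powR0 ?mulf_neq0 ?invr_eq0 ?pnatr_eq0.
    have -> : c x = 0 by apply/eqP; rewrite eq_le c0 andbT leNgt.
    exact: mul0r.
  rewrite addr_ge0 ?sqLp_ge0// mulr_ge0 ?sqLp_ge0// mulr_ge0 ?sqr_ge0//; lra.
have S0 q : 0 < S q.
  rewrite /S (bigD1 z)//= ltr_wpDr// ?mulr_gt0 ?expR_gt0// sumr_ge0// => x _.
  by rewrite mulr_ge0// expR_ge0.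
pose dS q := \sum_x c x * (ln (g x) * expR (q * ln (g x))).
pose phi q := expR (2 / q * ln (S q)).
pose dphi q := phi q * (2 / (q ^+ 2 * S q) * (q * dS q - S q * ln (S q))).
have phiE q : 0 < q -> sqLp mu q g = phi q.
  by move=> q0; rewrite /sqLp -SE ?gt_eqF// /powR gt_eqF.
have dphiP q : 0 < q -> is_derive q 1 phi (dphi q).
  by move=> q0; apply: is_derive_expR_ln_div => //; exact: is_derive_sum_expR.
have dphi_le q : 2 < q -> q <= p -> dphi q <= sigma ^+ 2 * sqLp mu p h.
  move=> q2 qp; have q0 : 0 < q by lra.
  (* Monotonicity in the exponent makes the bound independent of the intermediate point [q]. *)
  apply: (@le_trans _ _ (sigma ^+ 2 * sqLp mu q h)); last first.
    by apply: ler_wpM2l; [exact: sqr_ge0 | exact: sqLp_mono].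
  have := Ent_powR_le q2 g0 h0 gh; rewrite -SE ?gt_eqF//.
  have -> : Ent mu (fun x => g x `^ q) = q * dS q - S q * ln (S q).
    rewrite /Ent -SE ?gt_eqF//; congr (_ - _); rewrite /Exp /dS mulr_sumr.
    apply: eq_bigr => x _; rewrite ln_powR /c /powR; have := g0 x.
    rewrite le_eqVlt => /predU1P[<-|gx].
      by rewrite ltxx eqxx gt_eqF// !(mul0r, mulr0).
    by rewrite gx gt_eqF//; ring.
  rewrite /dphi; set E := q * dS q - _ => le.
  have -> : phi q = S q `^ (2 / q) by rewrite /powR gt_eqF.
  set a := S q `^ (2 / q); set b := S q `^ (1 - 2 / q) in le.
  (* The powers 2/q and 1 - 2/q of [S q] multiply to [S q], which cancels the denominator of [dphi];
     the factors q^2 cancel too. *)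
  have ab : a * b = S q.
    by rewrite -powRD ?(gt_eqF (S0 q)) ?implybT// addrC subrK powRr1 ?ltW.
  have a0 : 0 < a by exact: powR_gt0.
  have k0 : 0 <= a * (2 / (q ^+ 2 * S q)).
    by rewrite ltW// mulr_gt0// divr_gt0// mulr_gt0// exprn_gt0.
  rewrite mulrA; apply: le_trans (ler_wpM2l k0 le) _.
  have b0 : 0 < b by exact: powR_gt0.
  rewrite le_eqVlt -ab; apply/orP; left; apply/eqP.
  by field; rewrite !gt_eqF.
rewrite !phiE//; last by lra.
have [q||q /[!in_itv]/= /andP[q2 qp]] := @MVT R phi dphi 2 p p2.
- by rewrite in_itv /= => /andP[q2 _]; apply: dphiP; lra.
- apply: derivable_within_continuous => q; rewrite in_itv /= => /andP[q2 _].
  have q0 : 0 < q by lra.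
  exact: (@ex_derive _ _ _ _ _ _ _ (dphiP q q0)).
move=> E; rewrite -lerBlDl E [leRHS]mulrAC; apply: ler_wpM2r; first by rewrite subr_ge0 ltW.
by apply: dphi_le => //; exact: ltW.
Qed.

End LogSobolev.

(** * Tensors of higher order differences and the recursion between their norms *)

Section HigherOrder.
Variables (R : realType) (I X : finType) (mu : spin_system R I X).
Local Notation Y := {ffun I -> X}.
Implicit Types (f g h : Y -> R) (x : Y) (p q : R) (k d : nat).

(** Cauchy-Schwarz, by expanding a sum of squares of |b| a_i - |a| b_i; a zero vector is treated
    apart so that |a| |b| can be cancelled. *)
Lemma sum_mul_le_sqrt (T : finType) (a b : T -> R) :
  \sum_i a i * b i <=
  Num.sqrt (\sum_i a i ^+ 2) * Num.sqrt (\sum_i b i ^+ 2).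
Proof.
have ge0 (u : T -> R) : 0 <= \sum_i u i ^+ 2.
  by apply: sumr_ge0 => i _; exact: sqr_ge0.
have eq0 (u v : T -> R) : \sum_i u i ^+ 2 = 0 -> \sum_i u i * v i = 0.
  move=> /psumr_eq0P => u0; apply: big1 => i _; apply/eqP.
  rewrite mulf_eq0 -(sqrf_eq0 (u i)) u0 ?eqxx// => j _; exact: sqr_ge0.
set A := \sum_i a i ^+ 2; set B := \sum_i b i ^+ 2.
have := ge0 a; rewrite -/A le_eqVlt => /predU1P[A0|A0].
  by rewrite eq0// mulr_ge0 ?sqrtr_ge0.
have := ge0 b; rewrite -/B le_eqVlt => /predU1P[B0|B0].
  under eq_bigr do rewrite mulrC.
  by rewrite eq0// mulr_ge0 ?sqrtr_ge0.
have a0 : 0 < Num.sqrt A by rewrite sqrtr_gt0.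
have b0 : 0 < Num.sqrt B by rewrite sqrtr_gt0.
have := ge0 (fun i => Num.sqrt B * a i - Num.sqrt A * b i).
have -> : \sum_i (Num.sqrt B * a i - Num.sqrt A * b i) ^+ 2 =
   Num.sqrt B ^+ 2 * A + Num.sqrt A ^+ 2 * B
   - 2 * Num.sqrt A * Num.sqrt B * \sum_i a i * b i.
  rewrite /A /B !mulr_sumr -big_split -sumrB; apply: eq_bigr => i _ /=; ring.
rewrite !sqr_sqrtr ?ge0// => le.
by rewrite -(ler_pM2l (mulr_gt0 a0 b0)) -expr2 exprMn !sqr_sqrtr ?ge0//; lra.
Qed.

Lemma dist_sqrt_sum_le (T : finType) (a b : T -> R) :
  `|Num.sqrt (\sum_i a i ^+ 2) - Num.sqrt (\sum_i b i ^+ 2)| <=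
  Num.sqrt (\sum_i (a i - b i) ^+ 2).
Proof.
have ge0 (u : T -> R) : 0 <= \sum_i u i ^+ 2.
  by apply: sumr_ge0 => i _; exact: sqr_ge0.
rewrite -sqrtr_sqr ler_wsqrtr//.
have -> : \sum_i (a i - b i) ^+ 2 =
    \sum_i a i ^+ 2 + \sum_i b i ^+ 2 - 2 * \sum_i a i * b i.
  rewrite mulr_sumr -big_split -sumrB; apply: eq_bigr => i _ /=; ring.
have := sum_mul_le_sqrt a b.
by rewrite sqrrB !sqr_sqrtr ?ge0//; lra.
Qed.

Lemma big_tuple_cons k (F : seq I -> R) :
  \sum_(s : k.+1.-tuple I) F s = \sum_i \sum_(s : k.-tuple I) F (i :: s).
Proof.
rewrite pair_big /= (reindex (fun u : I * k.-tuple I => [tuple of u.1 :: u.2])) //=.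
exists (fun s : k.+1.-tuple I => (thead s, [tuple of behead s])) => [[i s] _|s _] /=.
  by congr pair; apply: val_inj.
by rewrite [s in RHS]tuple_eta.
Qed.

Lemma norm_h_ge0 k f x : 0 <= norm_h mu k f x.
Proof. exact: sqrtr_ge0. Qed.

Lemma sqr_norm_h k f x :
  norm_h mu k f x ^+ 2 = \sum_(s : k.-tuple I) diff_hs mu s f x ^+ 2.
Proof. by rewrite sqr_sqrtr// sumr_ge0// => s _; exact: sqr_ge0. Qed.

Lemma norm_h0 f x : norm_h mu 0 f x = `|f x|.
Proof.
rewrite /norm_h -sqrtr_sqr (bigD1 [tuple])//= big1 ?addr0// => s.
by rewrite [s]tuple0 => /eqP.
Qed.

Lemma diff_hs_subc f (c : R) (s : seq I) : (0 < size s)%N ->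
  diff_hs mu s (fun x => f x - c) = diff_hs mu s f.
Proof.
case: s => // i s _; elim: s i => [|j s IH] i.
  apply/funext => x; apply: eq_bigr => y _; congr `|_|; ring.
by rewrite -[LHS]/(diff_h mu i (diff_hs mu (j :: s) (fun x => f x - c))) IH.
Qed.

Lemma norm_h_subc f (c : R) k : (0 < k)%N ->
  norm_h mu k (fun x => f x - c) = norm_h mu k f.
Proof.
move=> k0; apply/funext => x; congr Num.sqrt; apply: eq_bigr => s _.
by rewrite diff_hs_subc// size_tuple.
Qed.

(** By the reverse triangle inequality, the oscillation of a Euclidean norm in one coordinate is at
    most the norm of the entrywise oscillations. The new index is the head of the tuple, that is,
    the outermost difference. *)
Lemma sum_sqr_diff_h_norm_h_le k f x :
  \sum_i diff_h mu i (norm_h mu k f) x ^+ 2 <= norm_h mu k.+1 f x ^+ 2.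
Proof.
rewrite sqr_norm_h (big_tuple_cons _ (fun s => diff_hs mu s f x ^+ 2)).
apply: ler_sum => i _.
set D := \sum_(s : k.-tuple I) _.
have D0 : 0 <= D by apply: sumr_ge0 => s _; exact: sqr_ge0.
rewrite -(sqr_sqrtr D0) lerXn2r ?nnegrE ?diff_h_ge0 ?sqrtr_ge0//.
apply: diff_h_le; first exact: sqrtr_ge0.
move=> y z y0 z0; apply: le_trans (dist_sqrt_sum_le _ _) _.
apply: ler_wsqrtr; apply: ler_sum => s _.
rewrite -real_normK ?num_real// lerXn2r ?nnegrE ?diff_h_ge0//.
exact: le_diff_h.
Qed.

Lemma sqLp2_norm_h k f : sqLp mu 2 (norm_h mu k f) = L2norm mu (norm_h mu k f) ^+ 2.
Proof.
rewrite sqLp2; last exact: norm_h_ge0.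
rewrite sqr_sqrtr; last by apply: Exp_ge0 => x; exact: sqr_ge0.
by apply: eq_Exp => x _; rewrite real_normK ?num_real.
Qed.

Lemma Loonorm_ge0 g : 0 <= Loonorm mu g.
Proof. by rewrite /Loonorm; elim/big_ind: _ => // a b a0 b0; rewrite le_max a0. Qed.

Lemma sqLp_le_Loonorm p k f : 0 < p ->
  sqLp mu p (norm_h mu k f) <= Loonorm mu (norm_h mu k f) ^+ 2.
Proof.
move=> p0; rewrite -(sqLp_cst mu p0 (Loonorm_ge0 _)).
apply: ler_sqLp => // x; first exact: norm_h_ge0.
move=> x0; apply: le_trans (ler_norm _) _.
exact: (@le_bigmax_cond _ _ _ _ x _ (fun x => `|norm_h mu k f x|)).
Qed.

Lemma Prob_ge0 (A : pred Y) : 0 <= Prob mu A.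
Proof. by apply: sumr_ge0 => x _; exact: mass_ge0. Qed.

Lemma Prob_le1 (A : pred Y) : Prob mu A <= 1.
Proof.
rewrite -(mass_sum1 mu) [leRHS](bigID A)/= lerDl.
by apply: sumr_ge0 => x _; exact: mass_ge0.
Qed.

Lemma markov_powR g p (t : R) : 0 <= p -> 0 <= t -> (forall x, 0 <= g x) ->
  Prob mu (fun x => t <= g x) * t `^ p <= Exp mu (fun x => g x `^ p).
Proof.
move=> p0 t0 g0; rewrite /Exp (bigID (fun x => t <= g x))/= /Prob mulr_suml.
apply: ler_wpDr; first by apply: sumr_ge0 => x _; rewrite mulr_ge0 ?mass_ge0 ?powR_ge0.
apply: ler_sum => x tx; rewrite ler_wpM2l ?mass_ge0//.
by rewrite ge0_ler_powR ?nnegrE.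
Qed.

Variable sigma : R.
Hypothesis hLSI : dLSI mu (sigma ^+ 2).

Lemma sqLp_norm_h_step f k p : 2 <= p ->
  sqLp mu p (norm_h mu k f) <=
  L2norm mu (norm_h mu k f) ^+ 2 + sigma ^+ 2 * p * sqLp mu p (norm_h mu k.+1 f).
Proof.
move=> p2; apply: le_trans (sqLp_growth hLSI p2 (norm_h_ge0 k f)
  (norm_h_ge0 k.+1 f) (sum_sqr_diff_h_norm_h_le k f)) _.
rewrite sqLp2_norm_h lerD2l; apply: ler_wpM2r; first exact: sqLp_ge0.
by apply: ler_wpM2l; [exact: sqr_ge0 | lra].
Qed.

(** The Poincare inequality absorbs the L^2 term of the growth bound: it costs sigma^2 once, and 1 +
    (p - 2) <= p. Hence no term of order 0 remains. *)
Lemma sqLp_centered_le f p : 2 <= p ->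
  sqLp mu p (fun x => `|f x - Exp mu f|) <=
  sigma ^+ 2 * p * sqLp mu p (norm_h mu 1 f).
Proof.
move=> p2; set f' := fun x => f x - Exp mu f.
have -> : (fun x => `|f x - Exp mu f|) = norm_h mu 0 f'.
  by apply/funext => x; rewrite norm_h0.
apply: le_trans (sqLp_growth hLSI p2 (norm_h_ge0 0 f')
  (norm_h_ge0 1 f') (sum_sqr_diff_h_norm_h_le 0 f')) _.
rewrite (norm_h_subc _ _ (ltn0Sn 0)); set M := sqLp mu p (norm_h mu 1 f).
have : sqLp mu 2 (norm_h mu 0 f') <= sigma ^+ 2 * M.
  rewrite sqLp2; last exact: norm_h_ge0.
  apply: (@le_trans _ _ (Exp mu (fun x => (f x - Exp mu f) ^+ 2))).
    by apply: ler_Exp => x _; rewrite norm_h0 real_normK ?num_real.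
  apply: le_trans (poincare hLSI f) _; apply: ler_wpM2l; first exact: sqr_ge0.
  have p0 : 0 < 2 :> R by [].
  apply: le_trans (sqLp_mono mu p0 p2 (norm_h_ge0 1 f)).
  rewrite sqLp2; last exact: norm_h_ge0.
  apply: ler_Exp => x _.
  rewrite sqr_norm_h (big_tuple_cons _ (fun s => diff_hs mu s f x ^+ 2)).
  by apply: ler_sum => i _; rewrite (bigD1 [tuple])//= lerDl sumr_ge0// => s _; exact: sqr_ge0.
have M0 : 0 <= M by exact: sqLp_ge0.
move=> le1; apply: le_trans (lerD le1 (lexx _)) _.
rewrite -[leRHS]mulrA -[_ * _ * M]mulrA -mulrDr.
apply: ler_wpM2l; first exact: sqr_ge0.
rewrite -{1}[M]mul1r -mulrDl; apply: ler_wpM2r => //.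
by lra.
Qed.

End HigherOrder.

(** * Iterated moment bounds and the tail estimate *)

Section Tail.
Variables (R : realType) (I X : finType) (mu : spin_system R I X).
Local Notation Y := {ffun I -> X}.
Implicit Types (f : Y -> R) (p t : R) (k d : nat).

Lemma powR_pow (x : R) k : (0 < k)%N -> 0 <= x -> (x `^ (2 / k%:R)) ^+ k = x ^+ 2.
Proof.
move=> k0 x0; rewrite -powR_mulrn ?powR_ge0// -powRrM divfK ?pnatr_eq0 -?lt0n//.
exact: powR_mulrn.
Qed.

(** The k-th power turns the exponents 2/k into squares and produces D^(2k), which is at least D^2
    because [1 <= D] and k is positive. *)
Lemma pow_mul_sqr_le (v N t D : R) k : (0 < k)%N -> 0 <= v -> 0 <= N -> 0 <= t ->
  1 <= D -> v * D ^+ 2 * N `^ (2 / k%:R) <= t `^ (2 / k%:R) ->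
  v ^+ k * N ^+ 2 <= t ^+ 2 / D ^+ 2.
Proof.
move=> k0 v0 N0 t0 D1 le.
have D0 : 0 < D by exact: lt_le_trans D1.
have L0 : 0 <= v * D ^+ 2 * N `^ (2 / k%:R).
  by rewrite mulr_ge0 ?powR_ge0// mulr_ge0 ?sqr_ge0.
have : (v * D ^+ 2 * N `^ (2 / k%:R)) ^+ k <= (t `^ (2 / k%:R)) ^+ k.
  by rewrite lerXn2r// nnegrE powR_ge0.
rewrite !exprMn !powR_pow// => {}le.
rewrite ler_pdivlMr ?exprn_gt0//; apply: le_trans le.
rewrite [leLHS]mulrAC; apply: ler_wpM2r; first exact: sqr_ge0.
apply: ler_wpM2l; first exact: exprn_ge0.
by rewrite -exprD ler_weXn2l// addnn (leq_double 1).
Qed.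

Variable sigma : R.
Hypothesis hLSI : dLSI mu (sigma ^+ 2).

Lemma sqLp_centered_iter f p (B : R) d : 2 <= p -> (0 < d)%N ->
  (forall k, (0 < k < d)%N ->
    (sigma ^+ 2 * p) ^+ k * L2norm mu (norm_h mu k f) ^+ 2 <= B) ->
  (sigma ^+ 2 * p) ^+ d * Loonorm mu (norm_h mu d f) ^+ 2 <= B ->
  sqLp mu p (fun x => `|f x - Exp mu f|) <= d%:R * B.
Proof.
move=> p2 d0 HL2 HLoo; set M := sqLp mu p _; set a := sigma ^+ 2 * p.
have p0 : 0 < p by exact: lt_le_trans p2.
have a0 : 0 <= a by rewrite mulr_ge0 ?sqr_ge0// ltW.
(* The orders 1 to j have each been bounded by [B], and order j + 1 is still an L^p norm. At j = d -
   1 that norm is bounded by the supremum, the d-th term. *)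
have step j : (j < d)%N ->
    M <= j%:R * B + a ^+ j.+1 * sqLp mu p (norm_h mu j.+1 f).
  elim: j => [_|j IH jd]; first by rewrite mul0r add0r; exact: sqLp_centered_le.
  apply: le_trans (IH (ltnW jd)) _; rewrite -natr1 mulrDl mul1r -addrA lerD2l.
  apply: le_trans (ler_wpM2l (exprn_ge0 _ a0) (sqLp_norm_h_step hLSI f j.+1 p2)) _.
  rewrite -/a mulrDr [a ^+ _ * (a * _)]mulrA -exprSr lerD2r; exact: HL2.
have := step d.-1; rewrite prednK// leqnn => /(_ isT) le; apply: le_trans le _.
rewrite -[in X in _ <= X](prednK d0) -natr1 mulrDl mul1r lerD2l.
apply: le_trans HLoo; apply: ler_wpM2l; first exact: exprn_ge0.
exact: sqLp_le_Loonorm.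
Qed.

(** The p-th moment is at most (t/e)^p = t^p exp(-p), and Markov's inequality divides by t^p. *)
Lemma Prob_le_of_sqLp f p t : 0 < p -> 0 < t ->
  sqLp mu p (fun x => `|f x - Exp mu f|) <= (t / expR 1) ^+ 2 ->
  Prob mu (fun x => t <= `|f x - Exp mu f|) <= expR (- p).
Proof.
move=> p0 t0; rewrite /sqLp; set W := Exp mu _ => le.
have W0 : 0 <= W by apply: Exp_ge0 => x; exact: powR_ge0.
have te0 : 0 <= t / expR 1 by rewrite divr_ge0 ?expR_ge0 ?ltW.
have {le} : W <= t `^ p * expR (- p).
  have p20 : 0 <= p / 2 by rewrite divr_ge0// ltW.
  have := ge0_ler_powR p20 _ _ le.
  rewrite !nnegrE powR_ge0 sqr_ge0 => /(_ isT isT).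
  rewrite -powR_mulrn// -!powRrM.
  have -> : 2 * (p / 2) = p by field.
  have -> : 2 / p * (p / 2) = 1 by field; rewrite gt_eqF.
  rewrite powRr1// powRM ?invr_ge0 ?expR_ge0 ?(ltW t0)// => /le_trans; apply.
  rewrite ler_wpM2l ?powR_ge0// -expRN /powR gt_eqF ?expR_gt0// expRK mulrN1.
  exact: lexx.
apply: contraTT; rewrite -!ltNge => lt.
have := markov_powR mu (g := fun x => `|f x - Exp mu f|) (ltW p0) (ltW t0) (fun=> normr_ge0 _).
by apply: lt_le_trans; rewrite mulrC ltr_pM2r// powR_gt0.
Qed.

(** Here [eta] is any lower bound for the minimum, stated without quotients so that vanishing norms
    are covered. The d terms t^2 / (d e)^2 sum to (t/e)^2 / d. *)
Lemma Prob_le_expR f p t (eta : R) d : 2 <= p -> 0 < t -> (0 < d)%N ->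
  (forall k, (0 < k < d)%N ->
    eta * L2norm mu (norm_h mu k f) `^ (2 / k%:R) <= t `^ (2 / k%:R)) ->
  eta * Loonorm mu (norm_h mu d f) `^ (2 / d%:R) <= t `^ (2 / d%:R) ->
  sigma ^+ 2 * (d%:R * expR 1) ^+ 2 * p <= eta ->
  Prob mu (fun x => t <= `|f x - Exp mu f|) <= expR (- p).
Proof.
move=> p2 t0 d0 HL2 HLoo le_eta.
have p0 : 0 < p by exact: lt_le_trans p2.
set D := d%:R * expR 1 in le_eta.
have d1 : 1 <= d%:R :> R by rewrite ler1n.
have D1 : 1 <= D by apply: mulr_ege1 => //; have := @expR_ge1Dx R 1; lra.
have bound k N : (0 < k)%N -> 0 <= N -> eta * N `^ (2 / k%:R) <= t `^ (2 / k%:R) ->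
    (sigma ^+ 2 * p) ^+ k * N ^+ 2 <= t ^+ 2 / D ^+ 2.
  move=> k0 N0 le; apply: pow_mul_sqr_le => //; last 1 first.
  - apply: le_trans le; apply: ler_wpM2r; first exact: powR_ge0.
    by rewrite mulrAC.
  - by rewrite mulr_ge0 ?sqr_ge0// ltW.
  - exact: ltW.
apply: Prob_le_of_sqLp => //.
apply: (@le_trans _ _ (d%:R * (t ^+ 2 / D ^+ 2))).
  apply: sqLp_centered_iter => // [k /andP[k0 kd]|].
    by apply: bound => //; [exact: sqrtr_ge0 | apply: HL2; rewrite k0].
  by apply: bound => //; exact: Loonorm_ge0.
have -> : d%:R * (t ^+ 2 / D ^+ 2) = d%:R^-1 * (t / expR 1) ^+ 2.
  by rewrite /D; field; rewrite gt_eqF ?expR_gt0//= pnatr_eq0 -lt0n.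
by rewrite ler_piMl ?sqr_ge0// invf_le1// (lt_le_trans ltr01).
Qed.

End Tail.

(** * Extended-real quotients, the constant C and the final case analysis *)

Lemma lee_div_mul (R : realType) (a b c : R) : 0 <= b -> 0 <= c ->
  (a%:E <= b%:E / c%:E)%E -> a * c <= b.
Proof.
(* With a zero denominator the quotient carries no information, and the product form reduces to
   [0 <= b]. *)
move=> b0 c0; rewrite inver; case: eqP => [->|/eqP cN0]; first by rewrite mulr0.
by rewrite -EFinM lee_fin ler_pdivlMr// lt_neqAle eq_sym cN0.
Qed.

(** The weaker exponent p ln 2 / 2 is what the constant C produces; it keeps the right-hand side at
    least 1 for p up to 2. *)
Lemma expR_ln2_le (R : realType) (p : R) : 0 <= p -> expR (- p) <= 2 * expR (- (p * ln 2 / 2)).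
Proof.
move=> p0; apply: (@le_trans _ _ (expR (- (p * ln 2 / 2)))); last first.
  by rewrite ler_peMl ?expR_ge0// ler1n.
have ln21 : ln 2 <= 1 :> R by have := @le_ln1Dx R 1; rewrite -natr1; apply; lra.
by rewrite ler_expR lerN2; nra.
Qed.

(* Quotients are taken in the extended reals, where x / 0 = +oo for x > 0. *)
Theorem theorem3p6 (R : realType) (I X : finType) (mu : spin_system R I X)
    (sigma : R) (hLSI : dLSI mu (sigma ^+ 2)) (d : nat) (hd : (0 < d)%N)
    (f : {ffun I -> X} -> R) (t : R) (ht : 0 < t) :
  let C : R := 2 * sigma ^+ 2 * (d%:R * expR 1) ^+ 2 / ln 2 in
  ((Prob mu (fun x => (t <= `|f x - Exp mu f|)%R))%:E <=
   2%:E * expeR (- (1%:E / C%:E *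
     mine ((t `^ (2 / d%:R))%:E / (Loonorm mu (norm_h mu d f) `^ (2 / d%:R))%:E)
          (\big[mine/+oo]_(1 <= k < d)
             ((t `^ (2 / k%:R))%:E /
              (L2norm mu (norm_h mu k f) `^ (2 / k%:R))%:E)))))%E.
Proof.
cbv zeta; set C := 2 * sigma ^+ 2 * _ / ln 2; set P := Prob mu _; set m := mine _ _.
have term_ge0 (a b : R) : (0 <= (a `^ b)%:E)%E by rewrite lee_fin powR_ge0.
have m0 : (0 <= m)%E.
  rewrite /m le_min mule_ge0 ?inve_ge0//=.
  by apply: le_bigmin => [|k _]; rewrite ?leey// mule_ge0 ?inve_ge0.
have tail eta p : (eta%:E <= m)%E -> 2 <= p ->
    sigma ^+ 2 * (d%:R * expR 1) ^+ 2 * p <= eta -> P <= expR (- p).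
  rewrite /m le_min => /andP[HLoo HL2] p2 le_eta.
  apply: (Prob_le_expR hLSI p2 ht hd (eta := eta)) => // [k /andP[k0 kd]|].
    apply: lee_div_mul; [exact: powR_ge0 | exact: powR_ge0 |].
    apply: le_trans HL2 _.
    rewrite (bigD1_seq k) ?mem_index_iota ?k0 ?iota_uniq//=.
    by rewrite ge_min lexx.
  by apply: lee_div_mul HLoo; exact: powR_ge0.
have P0 : 0 <= P by exact: Prob_ge0.
have null : (forall p, 2 <= p -> P <= expR (- p)) -> P = 0.
  move=> HP; apply/eqP; rewrite eq_le P0 andbT leNgt; apply/negP => Pgt0.
  (* For this p, exp(p) >= 1 + p > 1/P, which contradicts P <= exp(-p). *)
  pose p := 2 + P^-1.
  have PV : 0 < P^-1 by rewrite invr_gt0.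
  have p2 : 2 <= p by rewrite lerDl ltW.
  have := HP p p2; rewrite leNgt => /negP; apply.
  rewrite expRN invf_plt ?posrE ?expR_gt0//.
  by have := expR_ge1Dx p; rewrite /p; lra.
have rhs_ge0 (y : \bar R) : (0 <= 2%:E * expeR y)%E by rewrite mule_ge0 ?expeR_ge0// lee_fin.
(* In the degenerate cases, [sigma = 0] or an infinite minimum, the tail bound holds for every p >=
   2, so the probability is 0. *)
have [s0|s0] := eqVneq sigma 0.
  rewrite null// => p p2; apply: (tail 0) => //.
  by rewrite s0 expr0n /= !mul0r.
have [moo|mfin] := eqVneq m +oo%E.
  by rewrite null// => p p2; apply: (tail _ p _ p2 (lexx _)); rewrite moo leey.
have mfn : m \is a fin_num by rewrite ge0_fin_numE// ltey.
rewrite -(fineK mfn); move: (fine m) (fineK mfn) => r mr.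
have r0 : 0 <= r by rewrite -lee_fin mr.
have ln2 : 0 < ln 2 :> R by rewrite ln_gt0// ltr1n.
have K0 : 0 < sigma ^+ 2 * (d%:R * expR 1) ^+ 2.
  by rewrite mulr_gt0 ?exprn_even_gt0//= mulf_neq0 ?pnatr_eq0 -?lt0n// gt_eqF ?expR_gt0.
set K := sigma ^+ 2 * _ in K0 tail.
have -> : C = 2 * K / ln 2 by rewrite /C /K mulrA.
pose p := r / K.
have C0 : 2 * K / ln 2 != 0 by rewrite gt_eqF// divr_gt0// mulr_gt0.
rewrite inver (negbTE C0) -!EFinM mul1r lee_fin.
have -> : (2 * K / ln 2)^-1 * r = p * ln 2 / 2 by rewrite /p; field; rewrite !gt_eqF.
have p0 : 0 <= p by rewrite divr_ge0// ltW.
have [p2|p2] := leP 2 p.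
  apply: le_trans (expR_ln2_le p0); apply: (tail r) => //; first by rewrite mr.
  by rewrite /p mulrC divfK// gt_eqF.
(* For p < 2 the exponent p ln 2 / 2 is at most ln 2, so the bound is trivial. *)
apply: le_trans (Prob_le1 mu _) _.
rewrite expRN ler_pdivlMr ?expR_gt0// mul1r -[leRHS]lnK ?posrE// ler_expR.
by rewrite mulrAC ler_piMl ?(ltW ln2)//; lra.
Qed.
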